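(* Consider $\mathcal{H},\mathcal{H}'$ two Hilbert spaces. Let $\mathcal{Y} \subset \mathcal{H}'$ be non-empty and $f:\mathcal{Y}\to\mathcal{H}$. Let $a: \mathcal{Y} \to \mathbb{R} \cup \{+\infty\}$, $b: \mathcal{H} \to \mathbb{R} \cup \{+\infty\}$, $A: \mathcal{Y} \to \mathcal{H}$ and $B: \mathcal{H} \to \mathcal{H}'$ be arbitrary functions. Assume that there is $\varphi: \mathcal{H} \to \mathbb{R} \cup \{+\infty\}$ such that $f(y) \in \arg\min_{x \in \mathcal{H}} \{D(x,y)+\varphi(x)\}$ for each $y \in \mathcal{Y}$, with $D(x,y) = a(y)-\langle x,A(y)\rangle+b(x)$. Then (a) the function $x \mapsto b(x)+\varphi(x)$ is convex on each convex subset $\mathcal{C}\subset\mathrm{Im}(f)$; (b) if $\mathrm{Im}(f)$ is convex, then the function $x \in \mathrm{Im}(f) \mapsto D(x,y)+\varphi(x)$ is convex, for all $y\in \mathcal{Y}$. Similarly, if there is $\varphi: \mathcal{H} \to \mathbb{R} \cup \{+\infty\}$ such that $f(y) \in \arg\min_{x \in \mathcal{H}} \{\widetilde D(x,y)+\varphi(x)\}$ for each $y \in \mathcal{Y}$, with $\widetilde D(x,y) = a(y)-\langle B(x),y\rangle+b(x)$, then $y \mapsto \langle B(f(y)),y\rangle-b(f(y))-\varphi(f(y))$ is convex on each convex subset $\mathcal{C}'\subset\mathcal{Y}$.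
   Context: The same notation $\langle\cdot,\cdot\rangle$ is used for the inner products of $\mathcal{H}$ and $\mathcal{H}'$. $\mathrm{Im}(f)=f(\mathcal{Y})$ is the image of $\mathcal{Y}$ under $f$. $\arg\min$ denotes the set of global minimizers.
   Formalization: The arg min is taken to contain only global minimizers at which the minimized function is finite (less than +∞); if every point counted as a minimizer of the constant +∞, the claim would fail, e.g. for a ≡ +∞, b = 0, f = id, φ(x) = −x². *)

(* Defs.v *)
From HB Require Import structures.
From mathcomp Require Import all_boot all_order all_algebra.
From mathcomp Require Import sesquilinear.
From mathcomp Require Import all_classical all_reals all_analysis.

Set Implicit Arguments.
Unset Strict Implicit.
Unset Printing Implicit Defensive.

Import Order.TTheory GRing.Theory Num.Theory.
Import numFieldNormedType.Exports.

Local Open Scope classical_set_scope.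
Local Open Scope ring_scope.
Local Open Scope convex_scope.

(* A real Hilbert space: a complete normed module over the reals whose norm is
   induced by an inner product, i.e. a symmetric positive definite bilinear
   form. *)
HB.mixin Record CompleteNormedModule_isHilbert (R : realType) (H : Type)
    of CompleteNormedModule R H := {
  inner : {dot H for idfun} ;
  innerE : forall x : H, inner x x = `|x| ^+ 2
}.

#[short(type="hilbertType")]
HB.structure Definition Hilbert (R : realType) :=
  {H of CompleteNormedModule_isHilbert R H & CompleteNormedModule R H}.

Notation "''[' x , y ]" := (inner x y) : ring_scope.

(* Functions into R `|` {+oo} are represented by functions into \bar R that
   never take the value -oo. *)
Definition ninfty_free (R : realType) (T : Type) (D : set T) (F : T -> \bar R) :=
  forall x, D x -> (-oo < F x)%E.

(* The set of global minimizers, with the usual convention of convex analysis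
   that a function identically equal to +oo has none: the minimum has to be
   < +oo (otherwise every point would minimize such a function). *)
Definition argmin (R : realType) (T : Type) (F : T -> \bar R) : set T :=
  [set x | (F x < +oo)%E /\ forall z, (F x <= F z)%E].

(* Extended-real-valued analogue of [convex_function]. It is only meant for
   functions that do not take both values -oo and +oo on C, so that the
   right-hand side is never of the form oo - oo. *)
Definition econvex_function (R : realType) (E : lmodType R)
    (E' := convex_lmodType E) (C : set E') (F : E' -> \bar R) :=
  forall t : {i01 R}, {in C &, forall x y : E',
    (F (x <| t |> y) <= t%:num%:E * F x + (1 - t%:num)%:E * F y)%E}.

(* Main.v *)
(** A function having at each point of a convex set an affine minorant that is
exact at that point is convex there. If [f y] minimizes [D(., y) + phi], then
comparing the value at [f y] with the value at [z] says precisely that [A y] is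
a subgradient of [b + phi] at [f y]. For [D'], comparing the minimizer at [z]
with the competitor [f y] says that [z |-> <B (f y), z> - b (f y) - phi (f y)]
is an affine minorant, exact at [y]. Minimal values being finite, [a y],
[b (f y)] and [phi (f y)] are finite, so these terms may be cancelled. *)
Require Import Defs.
From HB Require Import structures.
From mathcomp Require Import all_boot all_order all_algebra.
From mathcomp Require Import sesquilinear.
From mathcomp Require Import all_classical all_reals all_analysis.
From mathcomp Require Import ring lra.

Set Implicit Arguments.
Unset Strict Implicit.
Unset Printing Implicit Defensive.

Import Order.TTheory GRing.Theory Num.Theory.
Import numFieldNormedType.Exports.

Local Open Scope classical_set_scope.
Local Open Scope ring_scope.
Local Open Scope convex_scope.
Local Open Scope ereal_scope.

(** Since [-oo] absorbs [+oo] in a sum, a sum below [+oo] could hide an infinite addend; once [-oo]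
    is excluded, any addend [+oo] would make the whole sum [+oo]. *)
Lemma fin_num_addends (R : realType) (u v w : \bar R) (r : R) :
  -oo < u -> -oo < v -> -oo < w -> u - r%:E + v + w < +oo ->
  [/\ u \is a fin_num, v \is a fin_num & w \is a fin_num].
Proof. by case: u v w => [?| |] [?| |] [?| |]. Qed.

Lemma inner_convl (R : realType) (H : hilbertType R)
    (x y : convex_lmodType H) (z : H) (t : {i01 R}) :
  ('[x <| t |> y, z] = t%:num * '[x, z] + (1 - t%:num) * '[y, z])%R.
Proof. by rewrite linearDl !linearZl_LR. Qed.

Lemma inner_convr (R : realType) (H : hilbertType R)
    (z : H) (x y : convex_lmodType H) (t : {i01 R}) :
  ('[z, x <| t |> y] = t%:num * '[z, x] + (1 - t%:num) * '[z, y])%R.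
Proof. by rewrite linearDr !linearZr_LR. Qed.

Lemma affine_support_econvex (R : realType) (E : lmodType R)
    (C : set (convex_lmodType E)) (F : convex_lmodType E -> \bar R) :
  convex_set C ->
  (forall x, C x -> exists L : convex_lmodType E -> R,
    [/\ forall (t : {i01 R}) u v,
          (L (u <| t |> v) = t%:num * L u + (1 - t%:num) * L v)%R,
        F x = (L x)%:E & forall z, C z -> (L z)%:E <= F z]) ->
  econvex_function C F.
Proof.
move=> cvxC suppF t x y xC yC.
(* The support is taken at the convex combination itself, where it is exact; only its inequalities
   at the two endpoints are then used. *)
have /set_mem/suppF[L [affL -> leLF]] := cvxC x y t xC yC.
rewrite affL EFinD !EFinM leeD// lee_wpmul2l ?lee_fin ?subr_ge0//;
  by apply: leLF; apply: set_mem.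
Qed.

Theorem corollary4 (R : realType) (H H' : hilbertType R)
    (Y : set H') (f : H' -> H)
    (a : H' -> \bar R) (b : H -> \bar R) (A : H' -> H) (B : H -> H') :
  Y !=set0 ->
  ninfty_free Y a ->
  ninfty_free setT b ->
  (let D := fun (x : H) (y : H') => a y - ('[x, A y])%:E + b x in
   forall phi : H -> \bar R,
     ninfty_free setT phi ->
     (forall y, Y y -> argmin (fun x => D x y + phi x) (f y)) ->
     (forall C : set H, convex_set C -> C `<=` f @` Y ->
        econvex_function C (fun x => b x + phi x)) /\
     (convex_set (f @` Y) ->
        forall y, Y y -> econvex_function (f @` Y) (fun x => D x y + phi x))) /\
  (let D' := fun (x : H) (y : H') => a y - ('[B x, y])%:E + b x in
   forall phi : H -> \bar R,
     ninfty_free setT phi ->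
     (forall y, Y y -> argmin (fun x => D' x y + phi x) (f y)) ->
     forall C' : set H', convex_set C' -> C' `<=` Y ->
       econvex_function C'
         (fun y => ('[B (f y), y])%:E - b (f y) - phi (f y))).
Proof.
move=> _ a_gtNy b_gtNy.
(* The pairing is abstracted into [r], so that the same finiteness argument serves both [D] and
   [D']. *)
have finY (r : H -> H' -> R) phi : ninfty_free setT phi ->
    (forall y, Y y ->
       argmin (fun x => a y - (r x y)%:E + b x + phi x) (f y)) ->
    forall y, Y y -> [/\ a y \is a fin_num, b (f y) \is a fin_num &
      phi (f y) \is a fin_num].
  move=> phi_gtNy minf y Yy; have [+ _] := minf y Yy.
  by apply: fin_num_addends; [apply: a_gtNy|apply: b_gtNy|apply: phi_gtNy].
split=> [D phi phi_gtNy minf | D' phi phi_gtNy minf].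
- have fin := finY _ _ phi_gtNy minf.
  split=> [C cvxC CY | cvxY y Yy]; apply: affine_support_econvex => // x.
  + move=> /CY[y Yy <-{x}]; have [_ minfy] := minf y Yy.
    have [ay bfy phify] := fin y Yy.
    exists (fun z => fine (b (f y)) + fine (phi (f y)) +
                     ('[z, A y] - '[f y, A y]))%R; split.
    * by move=> t u v; rewrite inner_convl; ring.
    * by rewrite subrr addr0 EFinD !fineK.
    (* As [z] is itself a minimizer [f y'], [b] and [phi] are finite there too. The comparison is
       thus between reals, and [a y] cancels. *)
    * move=> z /CY[y' /fin[_ bfy' phify'] <-{z}]; move: (minfy (f y')).
      rewrite /D; move: ay bfy phify bfy' phify'.
      case: (a y) (b (f y)) (phi (f y)) (b (f y')) (phi (f y')) =>
        [?| |] [?| |] [?| |] [?| |] [?| |] //= _ _ _ _ _.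
      rewrite -!(EFinB,EFinD) !lee_fin; lra.
  + move=> [y1 Yy1 <-{x}]; have [_ minfy1] := minf y1 Yy1.
    have [ay _ _] := fin y Yy; have [ay1 bfy1 phify1] := fin y1 Yy1.
    (* This is the affine part of [D] at the fixed [y] plus the support of [b + phi] at [f y1],
       whose slope [A y1] comes from the minimality of [f y1] for the parameter [y1], not [y]. *)
    exists (fun z => fine (a y) - '[z, A y] + fine (b (f y1)) +
      fine (phi (f y1)) + ('[z, A y1] - '[f y1, A y1]))%R; split.
    * by move=> t u v; rewrite !inner_convl; ring.
    * by rewrite subrr addr0 !EFinD EFinN !fineK.
    * move=> z [y2 /fin[_ bfy2 phify2] <-{z}]; move: (minfy1 (f y2)).
      rewrite /D; move: ay ay1 bfy1 phify1 bfy2 phify2.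
      case: (a y) (a y1) (b (f y1)) (phi (f y1)) (b (f y2)) (phi (f y2)) =>
        [?| |] [?| |] [?| |] [?| |] [?| |] [?| |] //= _ _ _ _ _ _.
      rewrite -!(EFinB,EFinD) !lee_fin; lra.
- move=> C' cvxC' C'Y.
  have fin := finY _ _ phi_gtNy minf.
  apply: affine_support_econvex => // y /C'Y/fin[_ bfy phify].
  (* Freezing the minimizer at [f y] leaves [z] only in the second slot of the inner product, hence
     an affine function of [z]. *)
  exists (fun z => '[B (f y), z] - fine (b (f y)) - fine (phi (f y)))%R; split.
  + by move=> t u v; rewrite inner_convr; ring.
  + by rewrite !EFinB !fineK.
  + move=> z /C'Y Yz; have [_ /(_ (f y))] := minf z Yz.
    have [] := fin z Yz; rewrite /D'; move: bfy phify.
    case: (a z) (b (f z)) (phi (f z)) (b (f y)) (phi (f y)) =>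
      [?| |] [?| |] [?| |] [?| |] [?| |] //= _ _ _ _ _.
    rewrite -!(EFinB,EFinD) !lee_fin; lra.
Qed.
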